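(* Let $X=(X_t)_{t\in\mathbb{N}_0}$ be a discrete-time (time-homogeneous) Markov chain with Polish state space $\mathcal{S}$ and transition kernel $\mathsf{P}$. Assume there are a measurable set $K\subset\mathcal{S}$, a nonnegative measurable function $\varphi:\mathbb{N}_0\times\mathcal{S}\to[0,\infty[$, a nonnegative measurable function $V:\mathcal{S}\to\mathbb{R}$, and a positive sequence $(\theta(t))_{t\in\mathbb{N}_0}$ such that: (i) for every $x_0\in\mathcal{S}\setminus K$, with $\tau_K:=\inf\{t>0 : X_t\in K\}$, the process $(Y_{t\wedge\tau_K})_{t\in\mathbb{N}_0}$, where $Y_t:=\varphi(t,X_t)$, is a supermartingale under $\mathsf{P}_{x_0}$; (ii) $\varphi(t,x)\ge V(x)/\theta(t)$ for all $(t,x)\in\mathbb{N}_0\times\mathcal{S}$, and $C:=\sum_{t\in\mathbb{N}_0}\theta(t)<\infty$; (iii) $\delta:=\sup_{x\in K}V(x)<\infty$. Assume moreover that $$\beta:=\sup_{x_0\in K}\mathsf{E}\bigl[\varphi(0,X_1)\mathbf{1}_{\{X_1\in\mathcal{S}\setminus K\}}\,\big|\,X_0=x_0\bigr]<\infty,$$ and let $\gamma:=\sup_{t\in\mathbb{N}_0}\theta(t)$. Then for every $x_0\in\mathcal{S}$, $$\sup_{t\in\mathbb{N}_0}\mathsf{E}_{x_0}\bigl[V(X_t)\bigr]\le C\beta+\delta+\gamma\,\varphi(0,x_0).$$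
   Context: $\mathbb{N}_0=\{0,1,2,\ldots\}$. For $x\in\mathcal{S}$, $\mathsf{P}(x,\cdot)$ is the law of $X_{t+1}$ conditioned on $X_t=x$. $\mathsf{P}_{x_0}$ and $\mathsf{E}_{x_0}$ denote probability and expectation for the chain started at $X_0=x_0$. Supermartingales are with respect to the natural filtration of the chain. The infimum of the empty set is $+\infty$; $a\wedge b$ is the minimum. *)

(* Defs.v *)
From HB Require Import structures.
From mathcomp Require Import all_boot all_order all_algebra.
From mathcomp Require Import all_classical all_reals all_analysis.
From mathcomp Require Import measurable_realfun.
Set Implicit Arguments.
Unset Strict Implicit.
Unset Printing Implicit Defensive.
Import Order.TTheory GRing.Theory Num.Theory.
Local Open Scope classical_set_scope.
Local Open Scope ring_scope.

Definition is_distance (R : realType) (T : Type) (dist : T -> T -> R) : Prop :=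
  [/\ forall x y, 0 <= dist x y,
      forall x y, dist x y = 0 <-> x = y,
      forall x y, dist x y = dist y x
    & forall x y z, dist x z <= dist x y + dist y z].

Definition polish (R : realType) (T : topologicalType) : Prop :=
  (exists2 D : set T, countable D & dense D) /\
  exists dist : T -> T -> R,
    [/\ is_distance dist,
        forall (x : T) (A : set T), nbhs x A <->
          exists2 e : R, 0 < e & [set y | dist x y < e] `<=` A
      & forall u : nat -> T,
          (forall e : R, 0 < e -> exists N : nat, forall m n : nat,
             (N <= m)%N -> (N <= n)%N -> dist (u m) (u n) < e) ->
          exists l : T, u @ \oo --> l].

Notation borel T := (g_sigma_algebraType (@open T)).

(* Supremum in [0, +oo]: the supremum of the empty family is 0, not -oo. *)
Definition ge0_sup (R : realType) (T : Type) (A : set T) (f : T -> \bar R)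
  : \bar R := ereal_sup (0%E |` (f @` A)).

Section conditional_expectation.
Context (d : measure_display) (Omega : measurableType d) (R : realType).
Variable P : probability Omega R.

Definition sub_measurable (G : set (set Omega)) (g : Omega -> \bar R) : Prop :=
  forall B : set (\bar R), measurable B -> G (g @^-1` B).

(* g is a version of the conditional expectation of f given the
   sub-sigma-algebra G. *)
Definition is_cond_exp (G : set (set Omega)) (f g : Omega -> \bar R) : Prop :=
  [/\ sub_measurable G g,
      P.-integrable setT g
    & forall A, G A -> (\int[P]_(w in A) g w = \int[P]_(w in A) f w)%E].

Definition supermartingale (F : nat -> set (set Omega))
    (Y : nat -> Omega -> R) : Prop :=
  [/\ forall t, sub_measurable (F t) (EFin \o Y t),
      forall t, P.-integrable setT (EFin \o Y t)
    & forall t, exists2 Z : Omega -> \bar R,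
        is_cond_exp (F t) (EFin \o Y t.+1) Z
        & {ae P, forall w, (Z w <= (Y t w)%:E)%E}].

End conditional_expectation.

Section processes.
Context (d d' : measure_display) (Omega : measurableType d)
  (S : measurableType d') (R : realType).

Definition natural_filtration (X : nat -> Omega -> S) (t : nat)
  : set (set Omega) :=
  <<s \bigcup_(i in [set i : nat | (i <= t)%N])
        preimage_set_system setT (X i) measurable >>.

(* Under P, the process X is a time-homogeneous Markov chain with transition
   kernel p started at x0. *)
Definition markov_chain (p : R.-pker S ~> S) (X : nat -> Omega -> S)
    (P : probability Omega R) (x0 : S) : Prop :=
  {ae P, forall w, X 0%N w = x0} /\
  forall (t : nat) (B : set S), measurable B ->
    is_cond_exp P (natural_filtration X t)
      (EFin \o \1_(X t.+1 @^-1` B)) (fun w => p (X t w) B).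

(* inf {t > 0 | X_t \in K}, where None stands for +oo. *)
Definition return_time (X : nat -> Omega -> S) (K : set S) (w : Omega)
  : option nat :=
  match pselect (exists t : nat, (0 < t)%N && `[< K (X t w) >]) with
  | left h => Some (ex_minn h)
  | right _ => None
  end.

Definition min_time (t : nat) (tau : option nat) : nat :=
  if tau is Some s then minn t s else t.

Definition stopped (Y : nat -> Omega -> R) (tau : Omega -> option nat)
    (t : nat) (w : Omega) : R :=
  Y (min_time t (tau w)) w.

End processes.

(* Main.v *)
Require Import Defs.
From HB Require Import structures.
From mathcomp Require Import all_boot all_order all_algebra.
From mathcomp Require Import all_classical all_reals all_analysis.
From mathcomp Require Import measurable_realfun.

(* Let u_n(x) = E_x[V(X_n); X_0, ..., X_n \notin K]. For x outside K the stopped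
   supermartingale and V <= theta(n) phi(n, .) give u_n(x) <= theta(n) phi(0, x),
   so after averaging over the first step from y \in K the kernel applied to u_n
   is at most theta(n) beta. At time t, either X_t \in K and V(X_t) <= delta, or
   X_t \notin K; splitting the latter event according to the last visit to K
   before t bounds its contribution by the sum of theta(n) beta over n < t, plus
   u_t(x0) <= gamma phi(0, x0) when there was no visit at all. *)

Set Implicit Arguments.
Unset Strict Implicit.
Unset Printing Implicit Defensive.
Import Order.TTheory GRing.Theory Num.Theory.
Local Open Scope classical_set_scope.
Local Open Scope ring_scope.

(** * The Markov property for nonnegative measurable functions *)

Section markov_chains.
Import HBNNSimple.
Local Open Scope ereal_scope.
Context (d d' : measure_display) (Omega : measurableType d)
  (S : measurableType d') (R : realType).
Variables (p : R.-pker S ~> S) (X : nat -> {mfun Omega >-> S}).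
Local Notation F := (natural_filtration X).

Lemma natural_filtrationX i t B :
  (i <= t)%N -> measurable B -> F t (X i @^-1` B).
Proof.
move=> it mB; apply: sub_sigma_algebra; exists i => //.
by exists B => //; rewrite setTI.
Qed.

Lemma natural_filtration_measurable t A : F t A -> measurable A.
Proof.
apply: smallest_sub; first exact: sigma_algebra_measurable.
by move=> _ [i _ [B mB <-]]; rewrite setTI; exact: measurable_funPTI.
Qed.

Lemma natural_filtrationI s t A B :
  (s <= t)%N -> F s A -> F t B -> F t (A `&` B).
Proof.
move=> st FA FB; apply: (@measurableI _ (g_sigma_algebraType _)) => //.
suff : F s `<=` F t by apply.
by apply: sub_sigma_algebra2 => C [i /= si Ci]; exists i => //=; exact: leq_trans st.
Qed.

Lemma natural_filtrationT t : F t setT.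
Proof. by rewrite -(preimage_setT (X 0)); exact: natural_filtrationX. Qed.

Definition kernel_op (f : S -> \bar R) (x : S) : \bar R := \int[p x]_y f y.

Lemma kernel_op_ge0 f : (forall x, 0 <= f x) -> forall x, 0 <= kernel_op f x.
Proof. by move=> f0 x; exact: integral_ge0. Qed.

Lemma measurable_kernel_op f : (forall x, 0 <= f x) -> measurable_fun setT f ->
  measurable_fun setT (kernel_op f).
Proof.
move=> f0 mf; apply: measurable_fun_integral_kernel => // U mU.
exact: measurable_kernel.
Qed.

Section fixed_law.
Variables (P : probability Omega R) (x0 : S).
Hypothesis PX : markov_chain p X P x0.

Let markov_indic t A B : F t A -> measurable B ->
  \int[P]_(w in A) (\1_B (X t.+1 w))%:E = \int[P]_(w in A) p (X t w) B.
Proof.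
by move=> FA mB; have [_ /(_ t _ mB)[_ _ ->]] := PX.
Qed.

Let measurable_path (A : set Omega) (f : S -> \bar R) s :
  measurable_fun setT f -> measurable_fun A (f \o X s).
Proof. by move=> mf; apply: measurable_funTS; exact: measurableT_comp. Qed.

(** By linearity: both sides expand into finite sums over the values r of [h], compared term by term
    through [markov_indic]. *)
Let markov_nnsfun t A (h : {nnsfun S >-> R}) : F t A ->
  \int[P]_(w in A) (h (X t.+1 w))%:E =
  \int[P]_(w in A) kernel_op (EFin \o h) (X t w).
Proof.
move=> FA; have mA := natural_filtration_measurable FA.
under [LHS]eq_integral do rewrite fimfunE -fsumEFin//.
rewrite ge0_integral_fsum//; last 2 first.
  - move=> r; apply/measurable_EFinP/measurable_funM => //.
    by apply: measurable_funTS; apply: measurableT_comp.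
  - by move=> r w _; exact: nnfun_muleindic_ge0.
have -> : kernel_op (EFin \o h) = fun x =>
    \sum_(r \in range h) (r%:E * p x (h @^-1` [set r])).
  apply/funext => x; rewrite /kernel_op.
  under eq_integral do rewrite /= fimfunE -fsumEFin//.
  rewrite ge0_integral_fsum//; last 2 first.
    - by move=> r; exact/measurable_EFinP/measurable_funM.
    - by move=> r y _; exact: nnfun_muleindic_ge0.
  apply: eq_fsbigr => r _; rewrite -[LHS]/(\int[p x]_y ((r * _)%R)%:E).
  rewrite integralZl_indic_nnsfun// integral_indic// setIT//.
rewrite ge0_integral_fsum//; last 2 first.
  - move=> r; apply: measurable_funTS; apply: measurable_funeM.
    exact: measurableT_comp (measurable_kernel p _ _) _.
  - by move=> r w _; exact: nnsfun_mulemu_ge0.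
apply: eq_fsbigr => r _.
(* A negative r has empty preimage under the nonnegative [h], so both terms vanish; otherwise r can
   be pulled out of the integrals. *)
have [r0|r0] := leP 0%R r; last first.
  rewrite !integral0_eq//= => w _.
    by rewrite preimage_nnfun0// measure0 mule0.
  by rewrite preimage_nnfun0// indic0 mulr0.
under eq_integral do rewrite EFinM.
rewrite !ge0_integralZl//; last 2 first.
  - apply: measurable_funTS.
    exact: measurableT_comp (measurable_kernel p _ _) _.
  - by apply/measurable_EFinP; apply: measurable_funTS; apply: measurableT_comp.
by rewrite markov_indic.
Qed.

(** Extends the simple-function case by monotone convergence, applied under the kernel and then
    under [P] on each side. *)
Lemma markov_integral t A f : F t A -> measurable_fun setT f ->
  (forall x, 0 <= f x) ->
  \int[P]_(w in A) f (X t.+1 w) = \int[P]_(w in A) kernel_op f (X t w).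
Proof.
move=> FA mf f0; have mA := natural_filtration_measurable FA.
pose f_ := nnsfun_approx measurableT mf.
have cf z : lim ((f_ n z)%:E @[n --> \oo]) = f z.
  by apply/cvg_lim => //; exact: cvg_nnsfun_approx.
have ndf z : {homo (fun n => (f_ n z)%:E) : a b / (a <= b)%N >-> a <= b}.
  by move=> a b ab; rewrite lee_fin; exact/lefP/nd_nnsfun_approx.
have mf_ n : measurable_fun setT (EFin \o f_ n) by exact/measurable_EFinP.
have f_0 n z : 0 <= (EFin \o f_ n) z by rewrite /= lee_fin.
have -> : kernel_op f = fun x => lim (kernel_op (EFin \o f_ n) x @[n --> \oo]).
  apply/funext => x; rewrite /kernel_op -monotone_convergence//.
    by apply: eq_integral => y _; rewrite cf.
    by move=> z _; exact: ndf.
under eq_integral do rewrite -cf.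
rewrite monotone_convergence//; last 2 first.
- by move=> n; exact: measurable_path (mf_ n).
- by move=> n w _; exact: f_0.
rewrite monotone_convergence//; last 3 first.
- by move=> n; apply: measurable_path; exact: measurable_kernel_op.
- by move=> n w _; exact: kernel_op_ge0.
- move=> w _ a b ab; apply: ge0_le_integral => //.
    by move=> z _; exact: ndf.
by apply: congr_lim; apply/funext => n; exact: markov_nnsfun.
Qed.

Lemma integral_start f : measurable_fun setT f -> (forall x, 0 <= f x) ->
  \int[P]_w f (X 0%N w) = f x0.
Proof.
move=> mf f0; transitivity (\int[P]_w f x0).
  apply: ae_eq_integral => //; first exact: measurableT_comp.
  by have [X0 _] := PX; apply: filterS X0 => w -> _.
rewrite integral_cst// -[RHS]mule1; congr (_ * _); exact: probability_setT.
Qed.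

End fixed_law.
End markov_chains.

(** Testing the conditional expectation [Z] of the next value on the sure event shows that the mean
    does not increase in one step; induction leads back to time 0. *)
Lemma supermartingale_le_start (d : measure_display) (Omega : measurableType d)
    (R : realType) (P : probability Omega R) (F : nat -> set (set Omega))
    (Y : nat -> Omega -> R) (t : nat) :
  (forall s, F s setT) -> (forall s w, 0 <= Y s w) -> supermartingale P F Y ->
  (\int[P]_w (Y t w)%:E <= \int[P]_w (Y 0%N w)%:E)%E.
Proof.
move=> FT Y0 [_ iY sY]; elim: t => // t; apply: le_trans.
have [Z [_ iZ /(_ _ (FT t)) <-] ZY] := sY t.
(* [Z] may take negative values; passing to its positive part allows a comparison of nonnegative
   integrands, and the a.e. bound by [Y t] survives because [Y t] is nonnegative. *)
rewrite integralE (@le_trans _ _ (\int[P]_w (Z^\+ w)%E)%E)//.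
  by rewrite leeBlDr ?leeDl ?integral_ge0//; exact: integrable_neg_fin_num.
apply: ae_ge0_le_integral => //.
- by apply: measurable_funepos; exact: measurable_int iZ.
- by move=> w _; rewrite lee_fin.
- exact: measurable_int (iY t).
- by apply: filterS ZY => w ZYw _; rewrite funeposE ge_max lee_fin Y0 andbT.
Qed.

(** * Excursions away from [K]: kernel iterates and their path representation *)

Section excursions.
Local Open Scope ereal_scope.
Context (d d' : measure_display) (Omega : measurableType d)
  (S : measurableType d') (R : realType).
Variables (p : R.-pker S ~> S) (X : nat -> {mfun Omega >-> S}).
Variables (P : S -> probability Omega R).
Hypothesis markovX : forall x, markov_chain p X (P x) x.
Variables (K : set S) (V : S -> R).
Hypotheses (mK : measurable K) (mV : measurable_fun setT V)
  (V_ge0 : forall x, (0 <= V x)%R).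
Local Notation F := (natural_filtration X).

(* [excursion n x] is E_x[V(X_n); X_0, ..., X_n \notin K], written with
   iterates of the kernel so that its measurability in [x] is immediate. *)
Fixpoint excursion (n : nat) : S -> \bar R :=
  if n is m.+1 then kernel_op p (excursion m) \_ (~` K)
  else (EFin \o V) \_ (~` K).

Lemma excursion_ge0 n x : 0 <= excursion n x.
Proof.
elim: n x => [|n IH] /= x; apply: erestrict_ge0 => y _; first by rewrite lee_fin.
exact: kernel_op_ge0.
Qed.

Lemma measurable_excursion n : measurable_fun setT (excursion n).
Proof.
elim: n => [|n IH] /=; apply/(measurable_restrictT _ (measurableC mK)) => //.
  by apply: measurable_funTS; exact/measurable_EFinP.
by apply: measurable_funTS; apply: measurable_kernel_op => //; exact: excursion_ge0.
Qed.

Lemma excursion_in n x : K x -> excursion n x = 0.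
Proof. by case: n => [|n] Kx /=; rewrite patchE memNset//=; apply. Qed.

Lemma excursionS_out n x : ~ K x -> excursion n.+1 x = kernel_op p (excursion n) x.
Proof. by move=> Kx; rewrite /= patchE mem_set. Qed.

(** Time 0 is included here, whereas [return_time] looks only at positive times. *)
Definition avoids (n : nat) : set Omega :=
  [set w | forall i, (i <= n)%N -> ~ K (X i w)].

Lemma avoids0 : avoids 0 = X 0%N @^-1` (~` K).
Proof.
apply/seteqP; split => [w /(_ 0%N (leqnn _))//|w Kw i].
by rewrite leqn0 => /eqP ->.
Qed.

Lemma avoidsS n : avoids n.+1 = avoids n `&` X n.+1 @^-1` (~` K).
Proof.
apply/seteqP; split => [w Hw|w [Hw Kw] i].
  by split => [i ni|]; apply: Hw => //; exact: leqW.
by rewrite leq_eqVlt => /orP[/eqP ->//|]; rewrite ltnS; exact: Hw.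
Qed.

Lemma avoids_filtration n : F n (avoids n).
Proof.
elim: n => [|n IH].
  by rewrite avoids0; apply: natural_filtrationX => //; exact: measurableC.
rewrite avoidsS; apply: natural_filtrationI IH _ => //.
by apply: natural_filtrationX => //; exact: measurableC.
Qed.

(** Each induction step trades one application of the kernel for one time step of the chain, by the
    Markov property on the [F n]-event [avoids n]. *)
Lemma integral_excursion x n m :
  \int[P x]_(w in avoids n) excursion m (X n w) =
  \int[P x]_(w in avoids (n + m)) excursion 0 (X (n + m)%N w).
Proof.
elim: m n => [|m IH] n; first by rewrite addn0.
rewrite -addSnnS -IH.
rewrite (eq_integral (fun w => kernel_op p (excursion m) (X n w))); last first.
  by move=> w /set_mem Aw; rewrite excursionS_out//; exact: Aw.
rewrite -(markov_integral (markovX x) (@avoids_filtration n))//; last 2 first.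
- exact: measurable_excursion.
- exact: excursion_ge0.
(* The extra constraint at time n + 1 is free, since [excursion m] vanishes on [K]. *)
rewrite avoidsS integral_mkcondr; apply: eq_integral => w _.
rewrite patchE; case: ifPn => // /negP Kw; rewrite excursion_in//.
by apply: contrapT => Kw'; apply: Kw; exact: mem_set.
Qed.

Lemma excursionE n x : ~ K x ->
  excursion n x = \int[P x]_(w in avoids n) (V (X n w))%:E.
Proof.
move=> Kx; rewrite -(integral_start (markovX x)); last 2 first.
- exact: measurable_excursion.
- exact: excursion_ge0.
transitivity (\int[P x]_(w in avoids 0) excursion n (X 0%N w)).
  rewrite [RHS]integral_mkcond; apply: eq_integral => w _.
  rewrite patchE; case: ifPn => // /negP Kw; rewrite excursion_in//.
  by apply: contrapT => Kw'; apply: Kw; apply: mem_set; rewrite avoids0.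
rewrite integral_excursion add0n; apply: eq_integral => w /set_mem Aw.
by rewrite /= patchE mem_set//=; exact: Aw.
Qed.

(** On this event the return time exceeds n or is infinite, so stopping has not yet acted. *)
Lemma stopped_avoids (Y : nat -> Omega -> R) n w :
  avoids n w -> stopped Y (return_time X K) n w = Y n w.
Proof.
move=> Aw; rewrite /stopped /min_time /return_time; case: pselect => //= h.
case: ex_minnP => s /andP[s0 /asboolP Ks] _.
have [ns|sn] := leqP n s; first by congr (Y _ w); exact/minn_idPl.
by case: (Aw s (ltnW sn)).
Qed.

End excursions.

(** * Bounds on excursions and the decomposition at the last visit to [K] *)

Section excursion_bounds.
Local Open Scope ereal_scope.
Context (d d' : measure_display) (Omega : measurableType d)
  (S : measurableType d') (R : realType).
Variables (p : R.-pker S ~> S) (X : nat -> {mfun Omega >-> S}).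
Variables (P : S -> probability Omega R).
Hypothesis markovX : forall x, markov_chain p X (P x) x.
Variables (K : set S) (V : S -> R).
Hypotheses (mK : measurable K) (mV : measurable_fun setT V)
  (V_ge0 : forall x, (0 <= V x)%R).
Variables (phi : nat * S -> R) (theta : nat -> R).
Hypotheses (mphi : measurable_fun setT phi) (phi_ge0 : forall tx, (0 <= phi tx)%R)
  (theta_gt0 : forall t, (0 < theta t)%R)
  (V_le_phi : forall t x, (V x / theta t <= phi (t, x))%R)
  (supermart : forall x0 : S, ~ K x0 ->
     supermartingale (P x0) (natural_filtration X)
       (stopped (fun t w => phi (t, X t w)) (return_time X K))).
Local Notation exc := (excursion p K V).

Let mphi0 : measurable_fun setT (fun x => phi (0%N, x)).
Proof. exact: measurableT_comp mphi (pair1_measurable _). Qed.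

(** On paths avoiding [K], V is at most [theta n] times the stopped process at time n. Nonnegativity
    extends the integral to all paths, and the supermartingale property brings it back to time 0. *)
Lemma excursion_le n x : exc n x <= (theta n * phi (0%N, x))%:E.
Proof.
have th0 := ltW (theta_gt0 n).
have [Kx|nKx] := pselect (K x).
  by rewrite excursion_in// lee_fin mulr_ge0.
have [mY iY _] := supermart nKx.
set Y := stopped _ _ in mY iY.
have Y0 s w : (0 <= Y s w)%R by exact: phi_ge0.
have mav : measurable (avoids X K n).
  apply: (@natural_filtration_measurable _ _ _ _ X n); exact: avoids_filtration.
have mYn s : measurable_fun setT (EFin \o Y s) by exact: measurable_int (iY s).
have mthY : measurable_fun setT (fun w => (theta n)%:E * (Y n w)%:E).
  by apply: measurable_funeM; exact: mYn.
rewrite (excursionE markovX)//.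
apply: (@le_trans _ _ (\int[P x]_w ((theta n)%:E * (Y n w)%:E))).
  apply: (@le_trans _ _
      (\int[P x]_(w in avoids X K n) ((theta n)%:E * (Y n w)%:E))).
    apply: ge0_le_integral => //.
    - by move=> w _; rewrite lee_fin.
    - by apply: measurable_funTS; apply/measurable_EFinP; exact: measurableT_comp.
        - exact: measurable_funTS.
    - move=> w Aw; rewrite /Y stopped_avoids// -EFinM lee_fin.
      by rewrite mulrC -ler_pdivrMr.
  apply: ge0_subset_integral => //.
  by move=> w _; rewrite -EFinM lee_fin mulr_ge0.
rewrite ge0_integralZl//; [|exact: mYn|by move=> w _; rewrite lee_fin].
rewrite EFinM lee_wpmul2l ?lee_fin//.
apply: (@le_trans _ _ (\int[P x]_w (Y 0%N w)%:E)).
  apply: supermartingale_le_start (supermart nKx) => //.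
  exact: natural_filtrationT.
rewrite -(integral_start (markovX x) (f := fun y => (phi (0%N, y))%:E))//.
(* At time 0 stopping has no effect, because a minimum with 0 is 0. *)
- rewrite le_eqVlt; apply/orP; left; apply/eqP/eq_integral => w _.
  by rewrite /Y /stopped /min_time; case: return_time => // s; rewrite min0n.
- exact/measurable_EFinP.
- by move=> y; rewrite lee_fin.
Qed.

(** The kernel at [y] is the law of X_1 under [P y], so [excursion_le] applies at X_1; the indicator
    appears because [exc n] vanishes on [K]. *)
Lemma kernel_op_excursion_le n y :
  kernel_op p (exc n) y <= (theta n)%:E *
    'E_(P y)[fun w => (phi (0%N, X 1%N w) * \1_(~` K) (X 1%N w))%R].
Proof.
have th0 := ltW (theta_gt0 n).
have mexc := measurable_excursion p mK mV V_ge0 n.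
have exc0 := excursion_ge0 p K V_ge0 n.
rewrite -(integral_start (markovX y)); last 2 first.
- exact: measurable_kernel_op.
- exact: kernel_op_ge0.
rewrite -(markov_integral (markovX y) (@natural_filtrationT _ _ _ _ X 0%N))//.
have mf : measurable_fun setT (fun w =>
    (phi (0%N, X 1%N w) * \1_(~` K) (X 1%N w))%:E).
  apply/measurable_EFinP/measurable_funM.
    exact: (measurableT_comp mphi0).
  have mI : measurable_fun setT (\1_(~` K) : S -> R).
    by apply: measurable_indic; exact: measurableC.
  exact: (measurableT_comp mI).
rewrite unlock -ge0_integralZl//; last first.
  by move=> w _; rewrite lee_fin mulr_ge0.
apply: ge0_le_integral => //.
- exact: measurableT_comp.
- exact: measurable_funeM.
move=> w _; rewrite indicE; have [Kx|nKx] := pselect (K (X 1%N w)).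
  by rewrite excursion_in// memNset ?mulr0 ?mule0//; apply.
by rewrite mem_set// mulr1 -EFinM excursion_le.
Qed.

Variable beta : \bar R.
Hypotheses (beta_ge0 : 0 <= beta) (betaP : forall y, K y ->
  'E_(P y)[fun w => (phi (0%N, X 1%N w) * \1_(~` K) (X 1%N w))%R] <= beta).

(* The [i]-th summand accounts for the paths whose last visit to [K] occurs at
   time [t - 1 - i]. *)
Lemma expect_excursion_le x n t :
  \int[P x]_w exc n (X t w) <=
  \sum_(0 <= i < t) ((theta (n + i)%N)%:E * beta) + exc (n + t)%N x.
Proof.
have mexc k := measurable_excursion p mK mV V_ge0 k.
have exc0 k := excursion_ge0 p K V_ge0 k.
(* n stays general: each step back in time lengthens the excursion by one. *)
elim: t n => [|t IH] n.
  by rewrite big_nil add0e addn0 (integral_start (markovX x)).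
rewrite (markov_integral (markovX x) (@natural_filtrationT _ _ _ _ X t))//.
have tb0 : 0 <= (theta n)%:E * beta by rewrite mule_ge0// lee_fin ltW.
(* Pointwise split on X_t: in [K] the kernel term is at most [theta n] times [beta]; outside [K] it
   equals [exc n.+1], to which the induction hypothesis applies. *)
apply: (@le_trans _ _
    (\int[P x]_w ((theta n)%:E * beta + exc n.+1 (X t w)))).
  apply: ge0_le_integral => //.
  - by move=> w _; exact: kernel_op_ge0.
  - have mk : measurable_fun setT (kernel_op p (exc n)).
      exact: measurable_kernel_op.
    exact: (measurableT_comp mk).
  - by apply: emeasurable_funD => //; exact: (measurableT_comp (mexc n.+1)).
  move=> w _; have [Kw|nKw] := pselect (K (X t w)).
    rewrite excursion_in// adde0; apply: le_trans (kernel_op_excursion_le _ _) _.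
    by rewrite lee_wpmul2l ?lee_fin ?(ltW (theta_gt0 n))//; exact: betaP.
  by rewrite excursionS_out// leeDr.
rewrite ge0_integralD//; last exact: (measurableT_comp (mexc n.+1)).
rewrite integral_cst// [X in _ * X](_ : _ = 1); last exact: probability_setT.
rewrite mule1 big_nat_recl// addn0 -addeA leeD2l//.
by under eq_bigr do rewrite -addSnnS; rewrite -addSnnS.
Qed.

End excursion_bounds.

(** * The uniform moment bound *)

Theorem theorem2p2 (R : realType) (S : ptopologicalType) (polS : polish R S)
  (p : R.-pker (borel S) ~> (borel S))
  (d : measure_display) (Omega : measurableType d)
  (X : nat -> {mfun Omega >-> borel S})
  (P : borel S -> probability Omega R)
  (markovX : forall x0 : borel S, markov_chain p X (P x0) x0)
  (K : set (borel S)) (mK : measurable K)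
  (phi : nat * borel S -> R) (mphi : measurable_fun setT phi)
  (phi_ge0 : forall tx, 0 <= phi tx)
  (V : borel S -> R) (mV : measurable_fun setT V)
  (V_ge0 : forall x, 0 <= V x)
  (theta : nat -> R) (theta_gt0 : forall t, 0 < theta t)
  (supermart : forall x0 : borel S, ~ K x0 ->
     supermartingale (P x0) (natural_filtration X)
       (stopped (fun t w => phi (t, X t w)) (return_time X K)))
  (V_le_phi : forall t x, V x / theta t <= phi (t, x))
  (C delta beta gamma : \bar R)
  (CE : C = (\sum_(0 <= t <oo) (theta t)%:E)%E) (C_fin : (C < +oo)%E)
  (deltaE : delta = ge0_sup K (fun x => (V x)%:E)) (delta_fin : (delta < +oo)%E)
  (betaE : beta = ge0_sup K (fun x0 =>
     ('E_(P x0)[fun w => (phi (0%N, X 1%N w) * \1_(~` K) (X 1%N w))%R])%E))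
  (beta_fin : (beta < +oo)%E)
  (gammaE : gamma = ereal_sup (range (fun t => (theta t)%:E))) :
  forall x0 : borel S,
    (ereal_sup (range (fun t : nat => 'E_(P x0)[V \o X t]))
       <= C * beta + delta + gamma * (phi (0%N, x0))%:E)%E.
Proof.
move=> x0.
(* The point 0 adjoined in [ge0_sup] gives nonnegativity even when [K] is empty. *)
have beta_ge0 : (0 <= beta)%E.
  by rewrite betaE; apply: ereal_sup_ubound; left.
have delta_ge0 : (0 <= delta)%E.
  by rewrite deltaE; apply: ereal_sup_ubound; left.
have betaP y : K y -> ('E_(P y)[fun w =>
    (phi (0%N, X 1%N w) * \1_(~` K) (X 1%N w))%R] <= beta)%E.
  by move=> Ky; rewrite betaE; apply: ereal_sup_ubound; right; exists y.
have mexc := measurable_excursion p mK mV V_ge0 0.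
have exc0 := excursion_ge0 p K V_ge0 0.
apply: ge_ereal_sup => _ [t _ <-].
rewrite unlock.
(* V is at most [delta] on [K] and equals the excursion of length 0 outside it. *)
apply: (@le_trans _ _ (\int[P x0]_w (delta + excursion p K V 0 (X t w)))%E).
  apply: ge0_le_integral => //.
  - by move=> w _; rewrite lee_fin; exact: V_ge0.
  - by apply/measurable_EFinP; exact: (measurableT_comp mV).
  - by apply: emeasurable_funD => //; exact: (measurableT_comp mexc).
  move=> w _; have [Kw|nKw] := pselect (K (X t w)).
    rewrite excursion_in// adde0 deltaE; apply: ereal_sup_ubound; right.
    by exists (X t w).
  by rewrite /= patchE mem_set// leeDr.
rewrite ge0_integralD//; last exact: (measurableT_comp mexc).
rewrite integral_cst// [X in (_ * X)%E](_ : _ = 1%E); last exact: probability_setT.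
rewrite mule1 [leRHS]addeAC addeC leeD2r//.
apply: le_trans (expect_excursion_le markovX mK mV V_ge0 mphi phi_ge0 theta_gt0
  V_le_phi supermart beta_ge0 betaP x0 0 t) _.
(* The visits to [K] contribute a partial sum of the series [C], times [beta]; the path with no
   visit contributes [theta t], at most [gamma], times phi(0, x0). *)
apply: leeD.
  rewrite -ge0_sume_distrl; last by move=> i _; rewrite lee_fin ltW.
  rewrite lee_wpmul2r// CE; apply: nneseries_lim_ge => i _ _.
  by rewrite lee_fin ltW.
apply: le_trans (excursion_le markovX mK mV V_ge0 mphi phi_ge0 theta_gt0
  V_le_phi supermart _ x0) _.
rewrite EFinM lee_wpmul2r ?lee_fin// gammaE.
by apply: ereal_sup_ubound; exists t.
Qed.
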